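(* Let $\mathbb T$ be the Fraïssé limit of the class of all finite two-graphs. Then the automorphism group $\mathrm{Aut}(\mathbb T)$ has a dense, locally finite subgroup.
   Context: A two-graph is a 3-uniform hypergraph in which every set of four vertices contains an even number of hyperedges. The class of finite two-graphs is a Fraïssé class; $\mathbb T$ is its Fraïssé limit, the unique countable homogeneous two-graph whose finite substructures are exactly the finite two-graphs. $\mathrm{Aut}(\mathbb T)$ carries the topology of pointwise convergence; a group is locally finite if every finitely generated subgroup is finite. *)

(* Defs.v *)
From HB Require Import structures.
From mathcomp Require Import all_boot finmap monoid all_classical topology.

Set Implicit Arguments.
Unset Strict Implicit.
Unset Printing Implicit Defensive.

Local Open Scope classical_set_scope.
Local Open Scope fset_scope.

Section Hypergraph.
Implicit Types V W : choiceType.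

(* The set of hyperedges, on the vertex set [V].  Uniformity is not built in:
   it is part of [two_graph]. *)
Definition hypergraph V := {pred {fset V}}.

Definition two_graph V (E : hypergraph V) : Prop :=
  (forall e : {fset V}, e \in E -> #|` e| = 3) /\
  (forall S : {fset V}, #|` S| = 4 ->
     ~~ odd #|` [fset e in fpowerset S | e \in E]|).

Definition embedding W V (F : hypergraph W) (E : hypergraph V) (f : W -> V) :=
  injective f /\ forall e : {fset W}, (f @` e \in E) = (e \in F).

Record aut V (E : hypergraph V) := Aut {
  aut_fun :> V -> V;
  aut_inv : V -> V;
  aut_funK : cancel aut_fun aut_inv;
  aut_invK : cancel aut_inv aut_fun;
  aut_edge : forall e : {fset V}, (aut_fun @` e \in E) = (e \in E)
}.

(* An isomorphism between finite induced substructures is given by its domain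
   [A] and a total function [f], of which only the values on [A] matter; its
   codomain is the image of [A]. *)
Definition homogeneous V (E : hypergraph V) :=
  forall (A : {fset V}) (f : V -> V),
    {in A &, injective f} ->
    (forall e : {fset V}, e `<=` A -> (f @` e \in E) = (e \in E)) ->
    exists g : aut E, {in A, g =1 f}.

Definition fraisse_limit (K : forall W : finType, hypergraph W -> Prop)
    (V : countType) (E : hypergraph V) : Prop :=
  homogeneous E /\
  forall (W : finType) (F : hypergraph W),
    (exists f : W -> V, embedding F E f) <-> K W F.

End Hypergraph.

Section AutGroup.
Variables (V : choiceType) (E : hypergraph V).

Lemma autP (g h : aut E) : g =1 h -> g = h.
Proof.
case: g h => [f f' fK f'K fE] [k k' kK k'K kE] /= /funext fk.
subst k.
have f'k' : f' = k' by apply/funext => x; rewrite -{1}(k'K x) fK.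
subst k'; congr Aut; exact: Prop_irrelevance.
Qed.

HB.instance Definition _ := gen_eqMixin (aut E).
HB.instance Definition _ := gen_choiceMixin (aut E).

Lemma aut_one_edge (e : {fset V}) : (id @` e \in E) = (e \in E).
Proof. by rewrite imfset_id. Qed.

Definition aut_one : aut E := Aut (fun=> erefl) (fun=> erefl) aut_one_edge.

Lemma aut_mul_edge (g h : aut E) (e : {fset V}) :
  ((g \o h) @` e \in E) = (e \in E).
Proof. by rewrite imfset_comp !aut_edge. Qed.

Definition aut_mul (g h : aut E) : aut E :=
  Aut (can_comp (aut_funK g) (aut_funK h)) (can_comp (aut_invK h) (aut_invK g))
      (aut_mul_edge g h).

Lemma aut_inv_edge (g : aut E) (e : {fset V}) :
  (aut_inv g @` e \in E) = (e \in E).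
Proof.
rewrite -(aut_edge g) -imfset_comp.
suff -> : (g \o aut_inv g) @` e = e by [].
by rewrite -[RHS]imfset_id; apply: eq_imfset => // x; rewrite /= aut_invK.
Qed.

Definition aut_invg (g : aut E) : aut E :=
  Aut (aut_invK g) (aut_funK g) (aut_inv_edge g).

Lemma aut_mulA : associative aut_mul.
Proof. by move=> f g h; exact: autP. Qed.
Lemma aut_mul1 : left_id aut_one aut_mul.
Proof. by move=> f; exact: autP. Qed.
Lemma aut_mulr1 : right_id aut_one aut_mul.
Proof. by move=> f; exact: autP. Qed.
Lemma aut_mulV : left_inverse aut_one aut_invg aut_mul.
Proof. by move=> f; apply: autP => x; exact: aut_funK. Qed.
Lemma aut_mulrV : right_inverse aut_one aut_invg aut_mul.
Proof. by move=> f; apply: autP => x; exact: aut_invK. Qed.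

HB.instance Definition _ :=
  isGroup.Build (aut E) aut_mulA aut_mul1 aut_mulr1 aut_mulV aut_mulrV.

(* Pointwise convergence: the topology induced by the product topology on
   [V -> V], for [V] discrete. *)
HB.instance Definition _ := Topological.copy (aut E)
  (initial_topology (@aut_fun V E : aut E -> {ptws V -> discrete_topology V})).

End AutGroup.

Section LocallyFinite.
Variable G : groupType.
Implicit Types (S H K : set G).

Definition subgroup H := group_closed (mem H).

Definition generated S : set G := smallest subgroup S.

Definition locally_finite H :=
  forall S, finite_set S -> (generated S `<=` H)%classic -> finite_set (generated S).

End LocallyFinite.

(* Main.v *)
(* For a finite two-graph [A] on which [T] is the characteristic function of the
   hyperedges, with values in F_2, put on [B = A * F_2^A] the two-graph
     T((x, f), (y, g), (z, h)) = T(x, y, z) + u + u' + u'',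
   where the last three terms are [u = f(y) + g(x)] and its analogues for the
   other two pairs. Then [A] is the subset [A * {0}] of [B], and [Aut A] acts on
   [B] through its actions on [A] and [F_2^A], which extends its action on [A].
   Every isomorphism between substructures of [A] extends to an automorphism of
   [B]: a bijection of [A] extending it distorts [T] by a coboundary, which a
   shift of the second coordinates compensates. Every one-point extension of [A]
   embeds in [B] over [A]. So the limit is the union of a chain of finite
   substructures [A_n] with [A_(n+1) = A_n * F_2^(A_n)], and the automorphisms
   that respect these decompositions from some stage on form a subgroup, the
   union of the finite groups [Aut A_n]; it is dense by the extension property. *)

Require Import Defs.
From mathcomp Require Import all_boot finmap monoid all_classical topology.

Set Implicit Arguments.
Unset Strict Implicit.
Unset Printing Implicit Defensive.

Local Open Scope classical_set_scope.
Local Open Scope fset_scope.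

(** * Two-graphs as F_2-valued cocycles on triples *)

Definition triple (V : choiceType) (E : hypergraph V) (x y z : V) : bool :=
  [fset x; y; z] \in E.

(** The alternating 2-cocycles over F_2. The identity [cocycle_eq] is required also for coinciding
    points, so later computations need no distinctness hypotheses. Solved for [t x y z], it exhibits
    [t] as the coboundary of [t w], for any base point [w]. *)
Record cocycle (T : Type) (t : T -> T -> T -> bool) : Prop := Cocycle {
  cocycle_symL : forall x y z, t x y z = t y x z;
  cocycle_symR : forall x y z, t x y z = t x z y;
  cocycle_diag : forall x z, t x x z = false;
  cocycle_eq : forall w x y z, t x y z = t w x y (+) t w y z (+) t w x z
}.

Lemma coboundary_cocycle (T : Type) (u : T -> T -> bool) :
  (forall x y, u x y = u y x) -> (forall x, u x x = false) ->
  cocycle (fun x y z => u x y (+) u y z (+) u x z).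
Proof.
move=> uC u0; split=> [x y z|x y z|x z|w x y z].
- by rewrite (uC y x); case: (u x y); case: (u y z); case: (u x z).
- by rewrite (uC z y); case: (u x y); case: (u y z); case: (u x z).
- by rewrite u0 addbb.
- by case: (u w x); case: (u w y); case: (u w z); case: (u x y); case: (u x z);
     case: (u y z).
Qed.

Lemma imfset3 (V W : choiceType) (f : V -> W) x y z :
  f @` [fset x; y; z] = [fset f x; f y; f z].
Proof. by rewrite !imfsetU !imfset_fset1. Qed.

Lemma cardfs3P (V : choiceType) (e : {fset V}) :
  #|` e| = 3 -> exists x y z, e = [fset x; y; z].
Proof.
have: e =i enum_fset e by [].
case: (enum_fset e) => [|x [|y [|z [|? ?]]]] //= es _; exists x, y, z.
by apply/fsetP => w; rewrite es !inE orbA.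
Qed.

Lemma card_fset_uniq3 (V : choiceType) (x y z : V) :
  uniq [:: x; y; z] -> #|` [fset x; y; z]| = 3.
Proof.
move=> u3; have <- : [fset a in [:: x; y; z]] = [fset x; y; z].
  by apply/fsetP => a; rewrite in_fset !inE !orbA.
by rewrite card_fseq undup_id.
Qed.

Lemma card_fset_uniq4 (V : choiceType) (x y z w : V) :
  uniq [:: x; y; z; w] -> #|` [fset x; y; z; w]| = 4.
Proof.
move=> u4; have <- : [fset a in [:: x; y; z; w]] = [fset x; y; z; w].
  by apply/fsetP => a; rewrite in_fset !inE !orbA.
by rewrite card_fseq undup_id.
Qed.

Section Triples.
Variables (V : choiceType) (E : hypergraph V).

Lemma odd_edges_in_4set x y z w : uniq [:: x; y; z; w] ->
  (forall e : {fset V}, e \in E -> #|` e| = 3) ->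
  odd #|` [fset e in fpowerset [fset x; y; z; w] | e \in E]| =
  triple E x y z (+) triple E x y w (+) triple E x z w (+) triple E y z w.
Proof.
move=> u4 E3; set S := [fset x; y; z; w].
have SE a : (a \in S) = (a \in [:: x; y; z; w]) by rewrite !inE !orbA.
have S4 : #|` S| = 4 by exact: card_fset_uniq4.
(* An edge inside [S] has three elements, so it is the complement in [S] of one point. *)
pose s := [seq e <- [seq S `\ a | a <- [:: x; y; z; w]] | e \in E].
have us : uniq s.
  rewrite filter_uniq // map_inj_in_uniq // => a b; rewrite -!SE => aS bS eab.
  have := fsetD11 a S; rewrite eab in_fsetD1 aS andbT => /negbFE/eqP//.
have -> : #|` [fset e in fpowerset S | e \in E]| = size s.
  apply/perm_size/uniq_perm => // e; rewrite !inE /= mem_filter fpowersetE.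
  rewrite andbC; apply/andb_id2l => eE; apply/idP/mapP => [eS|[a _ ->]]; last first.
    exact: fsubD1set.
  have /eqP/cardfs1P [a Sea] : #|` S `\` e| = 1 by rewrite cardfsDS // S4 E3.
  have : a \in S `\` e by rewrite Sea inE.
  rewrite inE => /andP [_ aS]; exists a; first by rewrite -SE.
  by rewrite -(fsetDK eS) Sea.
move: u4; rewrite /= !inE !negb_or -!andbA.
move=> /and5P[/negPf xy /negPf xz /negPf xw /negPf yz /and3P[/negPf yw /negPf zw _]].
have Sx : S `\ x = [fset y; z; w].
  apply/fsetP => a; rewrite !inE; case: eqP => [->|]; rewrite ?xy ?xz ?xw //=.
have Sy : S `\ y = [fset x; z; w].
  apply/fsetP => a; rewrite !inE; case: (a =P y) => [->|]; rewrite ?(eq_sym y x) ?xy ?yz ?yw ?orbF //=.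
have Sz : S `\ z = [fset x; y; w].
  apply/fsetP => a; rewrite !inE; case: (a =P z) => [->|];
  by rewrite ?(eq_sym z x) ?(eq_sym z y) ?xz ?yz ?zw ?orbF //=.
have Sw : S `\ w = [fset x; y; z].
  apply/fsetP => a; rewrite !inE; case: (a =P w) => [->|];
  by rewrite ?(eq_sym w x) ?(eq_sym w y) ?(eq_sym w z) ?xw ?yw ?zw ?orbF //=.
rewrite /s size_filter /= Sx Sy Sz Sw /triple.
by do 4! case: (_ \in E).
Qed.

Lemma triple_symL x y z : triple E x y z = triple E y x z.
Proof. by rewrite /triple (fsetUC [fset x]). Qed.

Lemma triple_symR x y z : triple E x y z = triple E x z y.
Proof. by rewrite /triple fsetUAC. Qed.

Lemma triple_diag x z :
  (forall e : {fset V}, e \in E -> #|` e| = 3) -> triple E x x z = false.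
Proof. by move=> E3; apply/negP => /E3/eqP; rewrite fsetUid cardfs2; case: (x != z). Qed.

(** On four distinct vertices this is evenness. If two of them coincide, two of the four terms
    vanish and the other two are equal. *)
Lemma two_graph_cocycle : two_graph E -> cocycle (triple E).
Proof.
move=> E2; have d1 x z := triple_diag x z (proj1 E2).
split; [exact: triple_symL|exact: triple_symR|exact: d1|].
move=> w x y z.
have [u4|] := boolP (uniq [:: w; x; y; z]).
  have := proj2 E2 [fset w; x; y; z].
  rewrite odd_edges_in_4set //; last exact: (proj1 E2).
  move/(_ (card_fset_uniq4 u4)); case: (triple E x y z); do 3! case: (triple E w _ _) => //.
rewrite /= !inE !negb_and !negbK -!orbA.
have d2 a b : triple E a b b = false.
  by rewrite triple_symL triple_symR d1.
have d3 a b : triple E a b a = false by rewrite triple_symR d1.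
rewrite orbF => /orP[/eqP->|/orP[/eqP->|/orP[/eqP->|/orP[/eqP->|/orP[]/eqP->]]]].
- by rewrite !d1 addbF.
- by rewrite d3 d1 triple_symL.
- by rewrite !d3 !addbF triple_symR triple_symL.
- by rewrite d1 d2 addbb.
- by rewrite d3 d2 (triple_symR w y) addbF addbb.
- by rewrite !d2 addbF addbb.
Qed.
End Triples.

(** * From cocycles back to two-graphs *)

Definition hypergraph_of (W : finType) (t : W -> W -> W -> bool) : hypergraph W :=
  [pred e : {fset W} |
     [exists x, exists y, exists z, (e == [fset x; y; z]) && t x y z]].

Section HypergraphOf.
Variables (W : finType) (t : W -> W -> W -> bool).
Hypothesis tc : cocycle t.

Lemma hypergraph_ofP (e : {fset W}) :
  reflect (exists x y z, e = [fset x; y; z] /\ t x y z) (e \in hypergraph_of t).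
Proof.
apply: (iffP existsP) => [[x /existsP[y /existsP[z /andP[/eqP-> h]]]]|].
  by exists x, y, z.
move=> [x [y [z [-> h]]]]; exists x; apply/existsP; exists y; apply/existsP.
by exists z; rewrite eqxx.
Qed.

Lemma cocycle_uniq x y z : t x y z -> uniq [:: x; y; z].
Proof.
case: tc => sL sR d _; apply: contraTT; rewrite /= !inE andbT negb_and !negbK.
rewrite -?orbA => /or3P[] /eqP->; first by rewrite d.
  by rewrite sR d.
by rewrite sL sR d.
Qed.

Lemma triple_hypergraph_of x y z : triple (hypergraph_of t) x y z = t x y z.
Proof.
apply/hypergraph_ofP/idP => [[a [b [c [e h]]]]|]; last by exists x, y, z.
have [sL sR d _] := tc.
have := cocycle_uniq h; rewrite /= !inE andbT negb_or => /andP[/andP[/negPf ab /negPf ac] /negPf bc].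
have mem q : (q \in [fset x; y; z]) = (q \in [fset a; b; c]) by rewrite e.
have := mem a; have := mem b; have := mem c; rewrite !inE !eqxx ?orbT.
have : x \in [fset a; b; c] by rewrite -mem !inE eqxx.
have : y \in [fset a; b; c] by rewrite -mem !inE eqxx ?orbT.
have : z \in [fset a; b; c] by rewrite -mem !inE eqxx ?orbT.
(* Of the 27 assignments of [x, y, z] to [a, b, c], those that miss one of [a, b, c] contradict its
   membership in [[fset x; y; z]]; the permutations remain, and [t] is symmetric. *)
rewrite !inE => /orP[/orP[]|]/eqP-> /orP[/orP[]|]/eqP-> /orP[/orP[]|]/eqP->;
  rewrite ?eqxx ?ab ?ac ?bc ?(eq_sym b a) ?(eq_sym c a) ?(eq_sym c b) ?ab ?ac ?bc //= => _ _ _.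
- by rewrite sL sR sL.
- by rewrite sR sL.
- by rewrite sL sR.
- by rewrite sR.
- by rewrite sL.
Qed.

Lemma two_graph_hypergraph_of : two_graph (hypergraph_of t).
Proof.
have t3 (e : {fset W}) : e \in hypergraph_of t -> #|` e| = 3.
  by move=> /hypergraph_ofP[x [y [z [-> /cocycle_uniq/card_fset_uniq3]]]].
split=> // S S4.
have : S =i enum_fset S by []. have := fset_uniq S; move: S4.
case: (enum_fset S) => [|x [|y [|z [|w [|? ?]]]]] //= _ u4 SE.
have -> : S = [fset x; y; z; w] by apply/fsetP => a; rewrite SE !inE !orbA.
rewrite odd_edges_in_4set // !triple_hypergraph_of (cocycle_eq tc x y z w).
by do 3! case: (t x _ _).
Qed.

End HypergraphOf.

(** Edges on both sides have three elements and [f] preserves cardinality inside [A], so it suffices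
    to compare triples. *)
Lemma edge_of_triple (V W : choiceType) (E : hypergraph V) (F : hypergraph W)
    (f : W -> V) (A : {fset W}) :
  (forall e : {fset V}, e \in E -> #|` e| = 3) ->
  (forall e : {fset W}, e \in F -> #|` e| = 3) ->
  {in A &, injective f} ->
  {in A & &, forall x y z, triple E (f x) (f y) (f z) = triple F x y z} ->
  forall e : {fset W}, e `<=` A -> (f @` e \in E) = (e \in F).
Proof.
move=> E3 F3 fI fT e eA.
have fe : #|` f @` e| = #|` e|.
  by rewrite card_in_imfset // => x y xe ye; apply: fI; apply: (fsubsetP eA).
have [/cardfs3P[x [y [z E']]]|ne3] := #|` e| =P 3.
  move: eA; rewrite E' => /fsubsetP eA; rewrite imfset3; apply: fT;
  by apply: eA; rewrite !inE eqxx ?orbT.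
by apply/idP/idP => [/E3|/F3] //; rewrite fe.
Qed.

(** * The limit in terms of its cocycle *)

Section Limit.
Variables (V : countType) (E : hypergraph V).
Hypothesis limE : fraisse_limit (fun W : finType => @two_graph W) E.

Local Notation T := (triple E).

(** The inclusion of [S] is an embedding, so the substructure on [S] belongs to the class.
    Uniformity and the cocycle identity involve finitely many vertices, and are read off in such
    substructures. *)
Lemma limit_two_graph_pullback (S : {fset V}) :
  two_graph ([pred e : {fset S} | val @` e \in E] : hypergraph S).
Proof. by apply/(proj2 limE); exists val; split=> //; exact: val_inj. Qed.

Lemma limit_uniform (e : {fset V}) : e \in E -> #|` e| = 3.
Proof.
move=> eE; have [F3 _] := limit_two_graph_pullback e.
have ve : val @` [fset a : e | true] = e.
  apply/fsetP => x; apply/imfsetP/idP => [[a _ ->]|xe]; first exact: valP.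
  by exists [` xe]; rewrite ?inE.
by rewrite -[LHS]/(#|` e|) -{1}ve card_imfset //= ?F3 ?inE ?ve //; exact: val_inj.
Qed.

Lemma limit_cocycle : cocycle T.
Proof.
split=> [||x z|w x y z]; [exact: triple_symL|exact: triple_symR| |].
  by apply: triple_diag; exact: limit_uniform.
pose S := [fset w; x; y; z].
have tE (a b c : S) : T (val a) (val b) (val c) =
   triple ([pred e : {fset S} | val @` e \in E] : hypergraph S) a b c.
  by rewrite /triple inE imfset3.
have wS : w \in S by rewrite !inE eqxx.
have xS : x \in S by rewrite !inE eqxx orbT.
have yS : y \in S by rewrite !inE eqxx !orbT.
have zS : z \in S by rewrite !inE eqxx !orbT.
have := cocycle_eq (two_graph_cocycle (limit_two_graph_pullback S)) [` wS] [` xS] [` yS] [` zS].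
by rewrite -!tE.
Qed.

Lemma limit_universal (W : finType) (t : W -> W -> W -> bool) : cocycle t ->
  exists2 f : W -> V, injective f & forall x y z, T (f x) (f y) (f z) = t x y z.
Proof.
move=> tc; have /(proj2 limE)[f [fI fE]] := two_graph_hypergraph_of tc.
exists f => // x y z; by rewrite -(triple_hypergraph_of tc) /triple -fE imfset3.
Qed.

Lemma limit_homogeneous (A : {fset V}) (f : V -> V) :
  {in A &, injective f} ->
  {in A & &, forall x y z, T (f x) (f y) (f z) = T x y z} ->
  exists g : aut E, {in A, g =1 f}.
Proof.
move=> fI fT; apply: (proj1 limE) => //.
by apply: edge_of_triple => //; exact: limit_uniform.
Qed.

Lemma aut_triple (g : aut E) x y z : T (g x) (g y) (g z) = T x y z.
Proof. by rewrite /triple -imfset3 aut_edge. Qed.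

Lemma aut_of_triple (f : V -> V) : injective f -> (forall y, exists x, f x = y) ->
  (forall x y z, T (f x) (f y) (f z) = T x y z) -> exists g : aut E, g =1 f.
Proof.
move=> fI /choice[f' f'K] fT.
have fK : cancel f f' by move=> x; apply: fI; rewrite f'K.
have fE (e : {fset V}) : (f @` e \in E) = (e \in E).
  apply: (edge_of_triple (A := e)) => //; try exact: limit_uniform.
  by move=> x y _ _; exact: fI.
by exists (Aut fK f'K fE).
Qed.
End Limit.

(** * Injections of finite sets *)

Lemma in_inj_surj (V : choiceType) (A : {fset V}) (f : V -> V) :
  {in A &, injective f} -> {in A, forall x, f x \in A} ->
  forall y, y \in A -> exists2 x, x \in A & f x = y.
Proof.
move=> fI fA y yA.
have : y \in f @` A.
  suff -> : f @` A = A by [].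
  apply/eqP; rewrite eqEfcard card_in_imfset // leqnn andbT.
  by apply/fsubsetP => _ /imfsetP[x xA ->]; apply: fA.
by case/imfsetP => x xA ->; exists x.
Qed.

Lemma extend_injection (V : choiceType) (A X : {fset V}) (f : V -> V) :
  X `<=` A -> {in X &, injective f} -> {in X, forall x, f x \in A} ->
  exists h : V -> V, [/\ {in A &, injective h}, {in A, forall x, h x \in A}
                       & {in X, h =1 f}].
Proof.
move=> XA fI fA; pose C := A `\` X; pose D := A `\` f @` X.
have cCD : #|` C| = #|` D|.
  rewrite !cardfsDS // ?card_in_imfset //.
  by apply/fsubsetP => _ /imfsetP[x xX ->]; apply: fA.
(* Off [X], the equally long enumerations of [C] and [D] are matched position by position; the
   default of [nth] is never reached on [A]. *)
pose h x := if x \in X then f x else nth x (enum_fset D) (index x (enum_fset C)).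
have hD x : x \in A -> x \notin X -> h x \in D.
  move=> xA xX; rewrite /h (negbTE xX) mem_nth // -cCD index_mem.
  by rewrite -[_ \in _]/(x \in C) inE xX.
have hX x : x \in X -> h x \in f @` X by move=> xX; rewrite /h xX in_imfset.
exists h; split=> [x y xA yA|x xA|x xX]; last by rewrite /h xX.
- have [xX|xX] := boolP (x \in X); have [yX|yX] := boolP (y \in X).
  + by rewrite /h xX yX; exact: fI.
  + by move=> e; have := hD _ yA yX; rewrite -e inE hX.
  + by move=> e; have := hD _ xA xX; rewrite e inE hX.
  + have xC : x \in enum_fset C by rewrite -[_ \in _]/(x \in C) inE xX.
    have yC : y \in enum_fset C by rewrite -[_ \in _]/(y \in C) inE yX.
    rewrite /h (negbTE xX) (negbTE yX) (set_nth_default y x) -?cCD ?index_mem //.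
    move/eqP; rewrite nth_uniq -?cCD ?index_mem // => /eqP.
    exact: index_inj.
- have [xX|xX] := boolP (x \in X); first by rewrite /h xX fA.
  by have := hD _ xA xX; rewrite inE => /andP[].
Qed.

(** * The two-graph on [A * F_2^A] and its extension properties *)

Section Duplication.
Variables (V : countType) (E : hypergraph V).
Hypothesis limE : fraisse_limit (fun W : finType => @two_graph W) E.

Local Notation T := (triple E).
Let Tc : cocycle T := limit_cocycle limE.

(* [b |-> (p b, s b)] identifies [B] with [A * F_2^A], and [A] with [A * {0}]. *)
Record duplication (A B : {fset V}) (p : V -> V) (s : V -> V -> bool) : Prop := {
  dup_sub : A `<=` B;
  dup_proj : {in B, forall b, p b \in A};
  dup_id : {in A, forall a, p a = a};
  dup_zero : {in A &, forall a a', s a a' = false};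
  dup_inj : {in B &, forall b b', p b = p b' -> {in A, s b =1 s b'} -> b = b'};
  dup_surj : forall x (q : V -> bool), x \in A ->
    exists b, [/\ b \in B, p b = x & {in A, s b =1 q}];
  dup_edge : {in B & &, forall b c d, T b c d = T (p b) (p c) (p d) (+)
    (s b (p c) (+) s c (p b)) (+) (s c (p d) (+) s d (p c)) (+)
    (s b (p d) (+) s d (p b))}
}.

(** Universality provides a copy of [A * F_2^A] in the limit, and homogeneity moves it so that it
    contains [A] as [A * {0}] together with the prescribed vertex [v]. *)
Lemma exists_duplication (A : {fset V}) v : A != fset0 ->
  exists B p s, duplication A B p s /\ v \in B.
Proof.
case/fset0Pn => x0 x0A; have [sL sR d0 ceq] := Tc.
have dR a b : T a b b = false by rewrite sL sR d0.
pose W := (A * {ffun A -> bool})%type.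
(* Since [T] is the coboundary of [T x0], adding the fibre terms to [T x0] turns the structure
   wanted on [W] into the coboundary of [u], so it is a cocycle. *)
pose u (w w' : W) := T x0 (val w.1) (val w'.1) (+) (w.2 w'.1 (+) w'.2 w.1).
pose t (w w' w'' : W) := u w w' (+) u w' w'' (+) u w w''.
have tc : cocycle t.
  apply: coboundary_cocycle => [w w'|w]; first by rewrite /u sR (addbC (w.2 _)).
  by rewrite /u addbb addbF dR.
have [f fI fT] := limit_universal limE tc.
pose a0 : A := [` x0A].
(* A vertex [v] outside [A] goes to the fibre over [x0]. Its fibre function makes [u] equal to
   [T x0 v a] up to the constant 1; that constant makes the function nonzero at [x0], so that [v]
   and [x0] get distinct images. *)
pose i x : W := if insub x is Some a then (a, [ffun=> false])
                else (a0, [ffun a => ~~ T v x0 (val a)]).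
have iA x (xA : x \in A) : i x = ([` xA], [ffun=> false]).
  by rewrite /i insubT.
have iN x : x \notin A -> i x = (a0, [ffun a => ~~ T v x0 (val a)]).
  by move=> xA; rewrite /i insubN.
have iI : {in v |` A &, injective i}.
  have ne x y : x \in A -> y \notin A -> i x <> i y.
    move=> xA yA; rewrite (iA _ xA) (iN _ yA) => -[_ /ffunP/(_ a0)].
    by rewrite !ffunE /= dR.
  move=> x y; rewrite !inE.
  have [xA|xA] := boolP (x \in A); have [yA|yA] := boolP (y \in A) => //.
  - by move=> _ _; rewrite (iA _ xA) (iA _ yA) => -[].
  - by move=> _ _ /ne; case.
  - by move=> _ _ /esym/ne; case.
  - by rewrite !orbF => /eqP-> /eqP->.
have iu : {in v |` A &, forall x y,
    u (i x) (i y) = T x0 x y (+) (x \notin A) (+) (y \notin A)}.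
  move=> x y; rewrite !inE.
  have [xA|xA] := boolP (x \in A); have [yA|yA] := boolP (y \in A) => /=.
  - by move=> _ _; rewrite (iA _ xA) (iA _ yA) /u /= !ffunE !addbF.
  - rewrite orbF => _ /eqP yv; rewrite (iA _ xA) (iN _ yA) /u /= !ffunE /= yv.
    rewrite (sR x0 x) d0 (sL v) (sR x0 v).
    by case: (T _ _ _).
  - rewrite orbF => /eqP xv _; rewrite (iA _ yA) (iN _ xA) /u /= !ffunE /= xv.
    by rewrite d0 (sL v); case: (T _ _ _).
  - rewrite !orbF => /eqP xv /eqP yv; rewrite (iN _ xA) (iN _ yA) /u /= xv yv.
    by rewrite d0 addbb dR.
(* Each indicator of the complement of [A] occurs in two of the three terms of the coboundary and
   cancels. *)
have it : {in v |` A & &, forall x y z, t (i x) (i y) (i z) = T x y z}.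
  move=> x y z xA yA zA; rewrite /t !iu // (ceq x0 x y z).
  by case: (x \in A); case: (y \in A); case: (z \in A); do 3! case: (T x0 _ _).
have [g gE] : exists g : aut E, {in v |` A, g =1 f \o i}.
  apply: (limit_homogeneous limE) => [x y xA yA /fI /iI -> //|].
  by move=> x y z xA yA zA; rewrite /= fT it.
pose j w := aut_inv g (f w).
have jI : injective j by move=> w w' /(can_inj (aut_invK g)) /fI.
have jT w w' w'' : T (j w) (j w') (j w'') = t w w' w''.
  by rewrite -(aut_triple g) /j !aut_invK fT.
have ji : {in v |` A, forall x, j (i x) = x}.
  by move=> x xA; rewrite /j -[f _]/((f \o i) x) -gE // aut_funK.
(* The inverse of [j] on its range [B]; the default concerns only vertices outside [B]. *)
pose k b := odflt (i x0) [pick w | j w == b].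
have kj w : k (j w) = w.
  rewrite /k; case: pickP => [w' /eqP/jI->//|/(_ w)]; by rewrite eqxx.
pose B := [fset j w | w : W & true].
have BP b : b \in B -> exists w, b = j w by case/imfsetP => w _ ->; exists w.
have jB w : j w \in B by apply/imfsetP; exists w.
pose p b := val (k b).1.
pose s b a := if insub a is Some a' then (k b).2 a' else false.
have sE w (a : A) : s (j w) (val a) = w.2 a by rewrite /s valK kj.
exists B, p, s; split; last by rewrite -[v]ji ?jB // !inE eqxx.
have AB x : x \in A -> x = j (i x) by move=> xA; rewrite ji // inE xA orbT.
split.
- by apply/fsubsetP => x /AB->.
- by move=> b /BP[w ->]; rewrite /p kj; exact: valP.
- by move=> a aA; rewrite /p {1}(AB a aA) kj (iA _ aA).
- move=> a a' aA a'A; rewrite (AB _ aA) (iA _ aA).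
  by rewrite -[a']/(val [` a'A]) sE ffunE.
- move=> b b' /BP[w ->] /BP[w' ->]; rewrite /p !kj => /val_inj e1 e2.
  congr j; case: w w' e1 e2 => [a q] [a' q'] /= -> e2; congr pair.
  by apply/ffunP => c; have := e2 (val c) (valP c); rewrite !sE.
- move=> x q xA; exists (j ([` xA], [ffun a => q (val a)])); split=> //.
    by rewrite /p kj.
  by move=> a aA; rewrite -[a]/(val [` aA]) sE ffunE.
- move=> b c d /BP[w ->] /BP[w' ->] /BP[w'' ->]; rewrite jT /t /u /p !kj !sE.
  rewrite (ceq x0 (val w.1)).
  case: (w.2 _ (+) w'.2 _); case: (w'.2 _ (+) w''.2 _);
    case: (w.2 _ (+) w''.2 _); by do 3! case: (T x0 _ _).
Qed.

(** An automorphism of the finite substructure on [A], as a total function whose values off [A] are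
    irrelevant; surjectivity onto [A] follows from finiteness. *)
Definition partial_aut (A : {fset V}) (f : V -> V) :=
  [/\ {in A &, injective f}, {in A, forall x, f x \in A}
    & {in A & &, forall x y z, T (f x) (f y) (f z) = T x y z}].

(* A bijection [f] of [A] distorting [T] by the coboundary of the symmetrisation
   of [m] lifts to [B], by adding the function [m (p b)] to the fibre coordinate
   of [b]. *)
Lemma dup_extend A B p s (f : V -> V) (m : V -> V -> bool) :
  duplication A B p s ->
  {in A &, injective f} -> {in A, forall x, f x \in A} ->
  {in A & &, forall x y z, T (f x) (f y) (f z) = T x y z (+)
    (m x y (+) m y x) (+) (m y z (+) m z y) (+) (m x z (+) m z x)} ->
  exists k, [/\ partial_aut B k,
    {in B, forall b, p (k b) = f (p b)},
    {in B & A, forall b a, s (k b) (f a) = s b a (+) m (p b) a}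
    & {in A, forall x, {in A, forall a, m x a = false} -> k x = f x}].
Proof.
move=> dup fI fA fT.
have /choice[f' f'P] : forall y, exists x, y \in A -> x \in A /\ f x = y.
  move=> y; have [/(in_inj_surj fI fA)[x xA fx]|] := boolP (y \in A).
    by exists x.
  by exists y.
have f'f x : x \in A -> f' (f x) = x.
  by move=> xA; have [h1 h2] := f'P _ (fA _ xA); apply: fI.
(* Fibre coordinates are functions on [A], so after the shift by [m (p b)] they are transported
   along [f'], the inverse of [f] on [A]. *)
have /choice[k kP] : forall b, exists b', b \in B -> [/\ b' \in B,
    p b' = f (p b) & {in A, forall a, s b' a = s b (f' a) (+) m (p b) (f' a)}].
  move=> b; have [bB|] := boolP (b \in B); last by exists b.
  have [b' [b'B pb' sb']] := dup_surj dup
    (fun a => s b (f' a) (+) m (p b) (f' a)) (fA _ (dup_proj dup bB)).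
  by exists b'.
have kp : {in B, forall b, p (k b) = f (p b)} by move=> b /kP[].
have kB : {in B, forall b, k b \in B} by move=> b /kP[].
have ks : {in B & A, forall b a, s (k b) (f a) = s b a (+) m (p b) a}.
  by move=> b a /kP[_ _ kb] aA; rewrite kb ?f'f ?fA.
have pA := dup_proj dup.
have AB := fsubsetP (dup_sub dup).
exists k; split=> //.
- split=> // [b c bB cB kbc|b c d bB cB dB].
    have pbc : p b = p c by apply: fI; rewrite ?pA // -!kp // kbc.
    apply: (dup_inj dup) => // a aA.
    by have := ks b a bB aA; rewrite kbc ks // pbc => /addIb.
  rewrite (dup_edge dup bB cB dB) (dup_edge dup (kB b bB) (kB c cB) (kB d dB)).
  rewrite !kp // !ks ?pA // fT ?pA //.
  (* Regrouping collects the symmetrised shifts, which cancel the distortion of [T] by [f]. *)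
  rewrite !(addbACA _ (m _ _)).
  by case: (T _ _ _); do 3! case: (s _ _ (+) s _ _); do 3! case: (m _ _ (+) m _ _).
- move=> x xA mx; apply: (dup_inj dup); rewrite ?kB ?AB ?fA //.
    by rewrite kp ?AB // !(dup_id dup) ?fA.
  move=> a aA; have [h1 <-] := f'P _ aA.
  by rewrite ks ?AB // !(dup_zero dup) ?fA // (dup_id dup) ?mx.
Qed.

Lemma dup_extend_aut A B p s f : duplication A B p s -> partial_aut A f ->
  exists k, [/\ partial_aut B k,
    {in B, forall b, p (k b) = f (p b)},
    {in B & A, forall b a, s (k b) (f a) = s b a} & {in A, k =1 f}].
Proof.
move=> dup [fI fA fT].
have [|k [kB kp ks kf]] := dup_extend (m := fun _ _ => false) dup fI fA.
  by move=> x y z xA yA zA; rewrite fT // !addbF.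
exists k; split=> // [b a bB aA|x xA]; last by rewrite kf.
by rewrite ks // addbF.
Qed.

Lemma dup_extend_partial A B p s (X : {fset V}) f : duplication A B p s ->
  X `<=` A -> X != fset0 ->
  {in X &, injective f} -> {in X, forall x, f x \in A} ->
  {in X & &, forall x y z, T (f x) (f y) (f z) = T x y z} ->
  exists2 k, partial_aut B k & {in X, k =1 f}.
Proof.
move=> dup XA /fset0Pn[x0 x0X] fI fA fT; have [sL sR d0 ceq] := Tc.
have dR a b : T a b b = false by rewrite sL sR d0.
have [h [hI hA hX]] := extend_injection XA fI fA.
(* Based at [x0] and [h x0], [T] and its pullback along [h] are coboundaries, and [mu] is the
   difference of their primitives. Taking [x0] in [X] makes [mu] vanish on pairs from [X]. *)
pose mu x y := T (h x0) (h x) (h y) (+) T x0 x y.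
have muC x y : mu x y = mu y x by rewrite /mu sR (sR x0).
have mu0 x y : x \in X -> y \in X -> mu x y = false.
  by move=> xX yX; rewrite /mu !hX // fT // addbb.
(* The asymmetry makes [m x] vanish for every [x] in [X]. *)
pose m x y := (x \notin X) && ((y \in X) || (choice.pickle x < choice.pickle y)%N) && mu x y.
(* Every pair with [mu] nonzero is charged to exactly one endpoint: the one outside [X], or the one
   with the smaller code if both are outside. *)
have mS x y : m x y (+) m y x = mu x y.
  rewrite /m (muC y x).
  have [xX|xX] := boolP (x \in X); have [yX|yX] := boolP (y \in X) => //=.
  - by rewrite mu0.
  - by rewrite addbF.
  - case: ltngtP => /=; rewrite ?addbF // => /(pcan_inj choice.pickleK) ->.
    by rewrite /mu !dR.
have [|k [kB _ _ kf]] := dup_extend (m := m) dup hI hA.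
  move=> x y z xA yA zA; rewrite !mS /mu (ceq (h x0)) (ceq x0 x).
  by do 3! case: (T x0 _ _); do 3! case: (T (h x0) _ _).
exists k => // x xX; rewrite kf ?hX ?(fsubsetP XA _ xX) // => a _.
by rewrite /m xX.
Qed.
End Duplication.

(** * The chain of finite stages exhausting the limit *)

Lemma exists_duplication_chain (V : countType) (E : hypergraph V) :
  fraisse_limit (fun W : finType => @two_graph W) E ->
  exists A p s, [/\ forall n, duplication E (A n) (A n.+1) (p n) (s n),
    forall n, A n != fset0 & forall v, exists n, v \in A n].
Proof.
move=> limE.
(* The one-point two-graph yields a vertex; the first stage must be nonempty because duplication
   uses a base point in [A]. *)
have [|f _ _] := limit_universal limE (W := unit) (t := fun _ _ _ => false).
  by split.
pose x0 := f tt; pose stage := ({fset V} * (V -> V) * (V -> V -> bool))%type.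
have /choice[next nextP] : forall Av : {fset V} * V, exists r : stage,
    Av.1 != fset0 -> duplication E Av.1 r.1.1 r.1.2 r.2 /\ Av.2 \in r.1.1.
  case=> A v /=; have [->|A0] := eqVneq A fset0; first by exists (A, id, fun _ _ => true).
  by have [B [p [s h]]] := exists_duplication limE v A0; exists (B, p, s).
pose e n := odflt x0 (choice.unpickle n).
pose A := fix A n := if n is m.+1 then (next (A m, e m)).1.1 else [fset x0].
have A0 n : A n != fset0.
  elim: n => [|n /fset0Pn[y yA]]; first by apply/fset0Pn; exists x0; rewrite inE.
  have [|/= dup _] := nextP (A n, e n); first by apply/fset0Pn; exists y.
  by apply/fset0Pn; exists y; exact: (fsubsetP (dup_sub dup)).
exists A, (fun n => (next (A n, e n)).1.2), (fun n => (next (A n, e n)).2).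
split=> // [n|v]; first by have [|? _] := nextP (A n, e n); first exact: A0.
exists (choice.pickle v).+1; have [|_] := nextP (A (choice.pickle v), e (choice.pickle v)).
  exact: A0.
by rewrite /= /e choice.pickleK.
Qed.

(** * Automorphisms respecting the chain from some stage on *)

Section Chain.
Variables (V : countType) (E : hypergraph V).
Hypothesis limE : fraisse_limit (fun W : finType => @two_graph W) E.
Variables (A : nat -> {fset V}) (p : nat -> V -> V) (s : nat -> V -> V -> bool).
Hypothesis dup : forall n, duplication E (A n) (A n.+1) (p n) (s n).
Hypothesis A_neq0 : forall n, A n != fset0.
Hypothesis A_cover : forall v, exists n, v \in A n.

Lemma chain_mono m n : m <= n -> A m `<=` A n.
Proof.
move=> /subnK<-; elim: (n - m)%N => [|k IH]; first exact: fsubset_refl.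
by rewrite addSn; exact: fsubset_trans IH (dup_sub (dup _)).
Qed.

Lemma chain_mem m n x : m <= n -> x \in A m -> x \in A n.
Proof. by move=> /chain_mono/fsubsetP; apply. Qed.

Lemma chain_absorb (r : seq V) : exists n, {in r, forall x, x \in A n}.
Proof.
elim: r => [|x r [n IH]]; first by exists 0.
have [m xm] := A_cover x; exists (maxn m n) => y.
rewrite inE => /orP[/eqP->|yr]; first exact: chain_mem (leq_maxl _ _) xm.
exact: chain_mem (leq_maxr _ _) (IH _ yr).
Qed.

Definition preserves n (g : V -> V) :=
  [/\ {in A n, forall x, g x \in A n},
      {in A n.+1, forall b, p n (g b) = g (p n b)}
    & {in A n.+1 & A n, forall b a, s n (g b) (g a) = s n b a}].

(** A copy of the automorphism group of the two-graph on [A n]: restriction to [A n] is injective by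
    [stage_group_eq] and onto by [stage_group_extend]. *)
Definition stage_group n : set (aut E) :=
  [set g | forall m, n <= m -> preserves m g].

Lemma stage_group_mono m n : m <= n -> (stage_group m `<=` stage_group n)%classic.
Proof. by move=> mn g gm k nk; apply: gm; exact: leq_trans nk. Qed.

Lemma stage_groupM n g h : stage_group n g -> stage_group n h ->
  stage_group n (g * h)%g.
Proof.
move=> gn hn m nm; have [gA gp gs] := gn m nm; have [hA hp hs] := hn m nm.
have [hA' _ _] := hn m.+1 (leqW nm).
by split=> [x xA|b bA|b a bA aA] /=;
  rewrite ?gA ?gp ?gs ?hA ?hA' ?hp ?hs ?hA.
Qed.

Lemma stage_groupV n g : stage_group n g -> stage_group n g^-1%g.
Proof.
move=> gn.
have gA m (nm : n <= m) x : x \in A m -> exists2 y, y \in A m & x = g y.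
  have [gA _ _] := gn m nm => xA.
  have [|y yA <-] := in_inj_surj _ gA xA; last by exists y.
  by move=> ? ? _ _; exact: (can_inj (aut_funK g)).
have gK y : (g^-1)%g (g y) = y := aut_funK g y.
move=> m nm; have [gm gp gs] := gn m nm.
have pA := dup_proj (dup m).
have gA' := gA m.+1 (leqW nm).
split=> [x /(gA m nm)[y yA ->]|b /gA'[c cA ->]|b a /gA'[c cA ->] /(gA m nm)[d dA ->]];
  rewrite ?gK //.
- by rewrite gp // gK.
- by rewrite gs.
Qed.

Lemma stage_group_subgroup n : subgroup (stage_group n).
Proof.
split; first by rewrite inE => m _; split.
by move=> g h; rewrite !inE => gn hn; apply: stage_groupM => //; exact: stage_groupV.
Qed.

(** Induction along the chain: a point of the next stage is determined by its projection and its
    fibre function, and both are governed by the action one stage below, which [g] permutes. *)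
Lemma stage_group_eq n g h : stage_group n g -> stage_group n h ->
  {in A n, g =1 h} -> g = h.
Proof.
move=> gn hn gh.
have ghi i : {in A (n + i), g =1 h}.
  elim: i => [|i IH]; first by rewrite addn0.
  have ni : n <= n + i := leq_addr _ _; have nSi := leqW ni.
  have [gA gp gs] := gn _ ni; have [hA hp hs] := hn _ ni.
  have [gA' _ _] := gn _ nSi; have [hA' _ _] := hn _ nSi.
  rewrite addnS => b bA; apply: (dup_inj (dup (n + i))); rewrite ?gA' ?hA' //.
    by rewrite gp // hp // IH // (dup_proj (dup _)).
  move=> a aA; have [|c cA <-] := in_inj_surj _ gA aA.
    by move=> ? ? _ _; exact: (can_inj (aut_funK g)).
  by rewrite gs // IH // hs.
apply: autP => x; have [m xm] := A_cover x.
by apply: (ghi m); exact: chain_mem (leq_addl _ _) xm.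
Qed.

Lemma finite_stage_group n : finite_set (stage_group n).
Proof.
pose r (g : aut E) : {ffun A n -> A n} := [ffun a => insubd a (g (val a))].
suff rI : {in stage_group n &, injective r}.
  by rewrite -(eq_finite_set (inj_card_eq rI)); exact: finite_finset.
move=> g h; rewrite !inE => gn hn /ffunP rgh; apply: (stage_group_eq gn hn) => x xA.
have [gA _ _] := gn n (leqnn n); have [hA _ _] := hn n (leqnn n).
have /(congr1 val) := rgh [` xA].
by rewrite !ffunE /= !val_insubd gA ?hA.
Qed.

(** Iterating the induced extension gives compatible automorphisms of all later stages, whose union
    is an automorphism of the limit. *)
Lemma stage_group_extend n f : partial_aut E (A n) f ->
  exists2 g, stage_group n g & {in A n, g =1 f}.
Proof.
move=> fA.
have /choice[next nextP] : forall mk : nat * (V -> V), exists k,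
    partial_aut E (A mk.1) mk.2 ->
    [/\ partial_aut E (A mk.1.+1) k,
     {in A mk.1.+1, forall b, p mk.1 (k b) = mk.2 (p mk.1 b)},
     {in A mk.1.+1 & A mk.1, forall b a, s mk.1 (k b) (mk.2 a) = s mk.1 b a}
     & {in A mk.1, k =1 mk.2}].
  case=> m k /=; have [kA|nA] := pselect (partial_aut E (A m) k); last by exists k.
  by have [k' ?] := dup_extend_aut (dup m) kA; exists k'.
pose K := fix K i := if i is j.+1 then next ((n + j)%N, K j) else f.
have KA i : partial_aut E (A (n + i)) (K i).
  elim: i => [|i IH]; first by rewrite addn0.
  by rewrite addnS; have [] := nextP ((n + i)%N, K i) IH.
have Kp i : {in A (n + i).+1, forall b, p (n + i) (K i.+1 b) = K i (p (n + i) b)}.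
  by have [] := nextP ((n + i)%N, K i) (KA i).
have Ks i : {in A (n + i).+1 & A (n + i), forall b a,
    s (n + i) (K i.+1 b) (K i a) = s (n + i) b a}.
  by have [] := nextP ((n + i)%N, K i) (KA i).
have KS i : {in A (n + i), K i.+1 =1 K i}.
  by have [] := nextP ((n + i)%N, K i) (KA i).
have Kle i j x : i <= j -> x \in A (n + i) -> K j x = K i x.
  move=> /subnK<- xA; elim: (j - i)%N => [//|d IH].
  by rewrite addSn KS //; apply: chain_mem xA; rewrite leq_add2l leq_addl.
have /choice[N NP] : forall x, exists i, x \in A (n + i).
  by move=> x; have [i xi] := A_cover x; exists i; apply: chain_mem xi; exact: leq_addl.
(* The choice of a stage [N x] containing [x] does not affect the value, as each [K j] extends the
   earlier ones. *)
pose g x := K (N x) x.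
have gK i x : x \in A (n + i) -> g x = K i x.
  move=> xi; rewrite /g; case: (leqP i (N x)) => [ix|/ltnW xi'].
    exact: Kle.
  by rewrite [RHS](Kle _ _ _ xi').
have bound x y z : exists i, [/\ x \in A (n + i), y \in A (n + i) & z \in A (n + i)].
  have [i iP] := chain_absorb [:: x; y; z]; exists i.
  by split; apply: chain_mem (leq_addl _ _) (iP _ _); rewrite !inE eqxx ?orbT.
have gI : injective g.
  move=> x y; have [i [xA yA _]] := bound x y x; rewrite !(gK i) //.
  by have [KI _ _] := KA i; exact: KI.
have gT x y z : triple E (g x) (g y) (g z) = triple E x y z.
  have [i [xA yA zA]] := bound x y z; rewrite !(gK i) //.
  by have [_ _ KT] := KA i; exact: KT.
have gS y : exists x, g x = y.
  have [KI Km _] := KA (N y); have [x xA <-] := in_inj_surj KI Km (NP y).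
  by exists x; exact: gK.
have [h hg] := aut_of_triple limE gI gS gT.
exists h; last by move=> x xA; rewrite hg (gK 0) // addn0.
move=> m /subnKC<-; move: (m - n)%N => i.
have AS b : b \in A (n + i).+1 -> b \in A (n + i.+1) by rewrite addnS.
have [_ Km _] := KA i.
split=> [x xA|b bA|b a bA aA]; rewrite !hg.
- by rewrite (gK i) ?Km.
- by rewrite (gK i.+1) ?AS // Kp // (gK i) // (dup_proj (dup _)).
- by rewrite (gK i.+1) ?AS // (gK i) // Ks.
Qed.

(** * The union of the stage groups: local finiteness and density *)

Definition chain_group : set (aut E) := [set g | exists n, stage_group n g].

Lemma chain_group_subgroup : subgroup chain_group.
Proof.
split=> [|g h]; rewrite !inE.
  by exists 0; have [] := stage_group_subgroup 0; rewrite inE.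
move=> [m gm] [n hn]; exists (maxn m n).
have [_ /(_ g h)] := stage_group_subgroup (maxn m n); rewrite !inE; apply.
  exact: stage_group_mono (leq_maxl _ _) _ gm.
exact: stage_group_mono (leq_maxr _ _) _ hn.
Qed.

(** The stage groups increase, so finitely many elements lie in a single one, which is a finite
    subgroup. *)
Lemma chain_group_locally_finite : locally_finite chain_group.
Proof.
move=> S /finite_seqP[r SE] genS.
have [n nP] : exists n, forall g, g \in r -> stage_group n g.
  have : forall g, g \in r -> chain_group g.
    by move=> g gr; apply: genS; apply: sub_gen_smallest; rewrite SE.
  elim: r {SE} => [|g r IH] rc; first by exists 0.
  have [|n nP] := IH; first by move=> h hr; apply: rc; rewrite inE hr orbT.
  have [m gm] : chain_group g by apply: rc; rewrite mem_head.
  exists (maxn m n) => h; rewrite inE => /orP[/eqP->|/nP hn].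
    exact: stage_group_mono (leq_maxl _ _) _ gm.
  exact: stage_group_mono (leq_maxr _ _) _ hn.
apply: sub_finite_set (finite_stage_group n).
apply: smallest_sub; first exact: stage_group_subgroup.
by rewrite SE.
Qed.

(** Some stage [n] contains both [A i] and its image under [g]. The restriction of [g] to [A i]
    extends to an automorphism of stage [n.+1], and from there to the limit. *)
Lemma chain_group_approx (g : aut E) i :
  exists h, chain_group h /\ {in A i, h =1 g}.
Proof.
have [n nP] := chain_absorb (enum_fset (A i) ++ map g (enum_fset (A i))).
have [||x y _ _|x xA|x y z _ _ _|k kA kg] :=
    dup_extend_partial limE (X := A i) (f := g) (dup n).
- by apply/fsubsetP => x xA; apply: nP; rewrite mem_cat xA.
- exact: A_neq0.
- exact: (can_inj (aut_funK g)).
- by apply: nP; rewrite mem_cat map_f ?orbT.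
- exact: aut_triple.
have [h hn hk] := stage_group_extend kA.
exists h; split=> [|x xA]; first by exists n.+1.
rewrite hk ?kg //; apply: chain_mem (leqnSn n) _.
by apply: nP; rewrite mem_cat xA.
Qed.

Lemma chain_group_dense : dense chain_group.
Proof.
move=> O [g Og] [U Uop UO].
have /choice[h hP] := chain_group_approx g.
(* Every vertex lies in all [A i] from some stage on, so the values of [h i] there are eventually
   those of [g]. *)
have hg : ((fun i => aut_fun (h i) : {ptws V -> discrete_topology V}) @ \oo -->
            (aut_fun g : {ptws V -> discrete_topology V}))%classic.
  apply/cvg_sup => x C [_ [[D Dop <-] Dg] DC].
  have [n xn] := A_cover x; exists n => // i /= ni; apply: DC => /=.
  by rewrite (proj2 (hP i)) //; exact: chain_mem xn.
have /hg[n _ nP] : nbhs (aut_fun g : {ptws V -> discrete_topology V}) U.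
  by apply: open_nbhs_nbhs; split=> //; rewrite -UO in Og.
exists (h n); split; last exact: (proj1 (hP n)).
by rewrite -UO; apply: nP => /=.
Qed.
End Chain.

Theorem theorem5p1 (V : countType) (E : hypergraph V)
    (limE : fraisse_limit (fun W : finType => @two_graph W) E) :
  exists H : set (aut E), [/\ subgroup H, dense H & locally_finite H].
Proof.
have [A [p [s [dup A0 Acov]]]] := exists_duplication_chain limE.
exists (chain_group A p s); split.
- exact: chain_group_subgroup.
- exact: chain_group_dense.
- exact: chain_group_locally_finite.
Qed.
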